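(* Let $\mathcal{J}_1$ be the set consisting of exactly one path of each length $n\ge 0$, $n\neq 1$, namely $(UD)^{n/2}$ if $n$ is even, and $(UD)^{(n-3)/2}UUC_2$ if $n$ is odd. Let $\mathcal{J}$ be the union of $\mathcal{J}_1$ with the set of paths of the form $\alpha_1U^{k_1+1}DC_{k_1}\alpha_2U^{k_2+1}DC_{k_2}\cdots\alpha_rU^{k_r+1}DC_{k_r}\alpha_{r+1}$ where $r\ge 1$, all $k_i$ are at least $2$, and all $\alpha_i$ ($1\le i\le r+1$) are in $\mathcal{J}_1$. The ordinary generating function $J(x)=\sum_{P\in\mathcal{J}}x^{|P|}$ of $\mathcal{J}$ with respect to the length is $$J(x)=\frac{x^3-2x^2+2x-1}{x^7-x^6+x^5-x^2+2x-1},$$ and its series expansion is $$1+x^2+x^3+x^4+2x^5+2x^6+4x^7+6x^8+9x^9+14x^{10}+20x^{11}+O(x^{12}).$$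
   Context: Paths are lattice paths in the first quadrant ($y\ge 0$) starting at the origin and ending on the $x$-axis, written as words in the steps $U=(1,1)$, $D=(1,-1)$ and catastrophe steps $C_k=(1,-k)$, $k\ge 2$, where a catastrophe step must end on the $x$-axis (so $C_k$ can only be used from height $k$); these are called Dyck paths with catastrophes. The length $|P|$ is the number of steps of $P$; the empty path has length $0$. Generating functions are formal power series in $x$. *)

(* Defs.v *)
From HB Require Import structures.
From mathcomp Require Import all_boot all_order all_algebra.
From mathcomp Require Import mathcomp_extra boolp classical_sets functions.
From mathcomp Require Import cardinality.
From mathcomp Require Import finmap.

Set Implicit Arguments.
Unset Strict Implicit.
Unset Printing Implicit Defensive.
Set Warnings "-redundant-canonical-projection".

Import GRing.Theory.
Local Open Scope ring_scope.

(* The ring of formal power series over a commutative ring with units; *)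
(* the quotient f / g is meaningful when the constant term of g is a   *)
(* unit, by [fps_unitP].                                               *)

Record fps (R : Type) := Fps { fps_coef :> nat -> R }.

HB.instance Definition _ (R : Type) := gen_eqMixin (fps R).
HB.instance Definition _ (R : Type) := gen_choiceMixin (fps R).

Lemma fpsP (R : Type) (f g : fps R) : f =1 g -> f = g.
Proof. by case: f g => [f] [g] /= fg; congr Fps; apply: funext. Qed.

Section FpsRing.
Variable R : comUnitRingType.
Implicit Types f g h : fps R.

Definition fps_zero : fps R := Fps (fun=> 0).
Definition fps_one : fps R := Fps (fun n => (n == 0%N)%:R).
Definition fps_opp f : fps R := Fps (fun n => - f n).
Definition fps_add f g : fps R := Fps (fun n => f n + g n).
Definition fps_mul f g : fps R :=
  Fps (fun n => \sum_(i < n.+1) f i * g (n - i)%N).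

Fact fps_addA : associative fps_add.
Proof. by move=> f g h; apply: fpsP => n /=; rewrite addrA. Qed.
Fact fps_addC : commutative fps_add.
Proof. by move=> f g; apply: fpsP => n /=; rewrite addrC. Qed.
Fact fps_add0 : left_id fps_zero fps_add.
Proof. by move=> f; apply: fpsP => n /=; rewrite add0r. Qed.
Fact fps_addN : left_inverse fps_zero fps_opp fps_add.
Proof. by move=> f; apply: fpsP => n /=; rewrite addNr. Qed.

HB.instance Definition _ :=
  GRing.isZmodule.Build (fps R) fps_addA fps_addC fps_add0 fps_addN.

Let trunc N f : {poly R} := \poly_(i < N) f i.

Let coef_mul_trunc N f g n : (n < N)%N ->
  (trunc N f * trunc N g)`_n = fps_mul f g n.
Proof.
move=> nN; rewrite coefM /=; apply: eq_bigr => i _.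
by rewrite !coef_poly (leq_trans (ltn_ord i) nN) (leq_ltn_trans (leq_subr _ _) nN).
Qed.

Fact fps_mulC : commutative fps_mul.
Proof.
move=> f g; apply: fpsP => n.
by rewrite -!(coef_mul_trunc _ _ (ltnSn n)) mulrC.
Qed.

Fact fps_mulA : associative fps_mul.
Proof.
move=> f g h; apply: fpsP => n.
transitivity ((trunc n.+1 f * (trunc n.+1 g * trunc n.+1 h))`_n).
  rewrite coefM /=; apply: eq_bigr => i _.
  by rewrite coef_poly ltn_ord coef_mul_trunc// ltnS leq_subr.
rewrite mulrA coefM /=; apply: eq_bigr => i _.
by rewrite coef_mul_trunc ?ltn_ord// coef_poly ltnS leq_subr.
Qed.

Fact fps_mul1 : left_id fps_one fps_mul.
Proof.
move=> f; apply: fpsP => n /=; rewrite big_ord_recl /= mul1r subn0.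
by rewrite big1 ?addr0// => i _; rewrite mul0r.
Qed.

Fact fps_mulDl : left_distributive fps_mul fps_add.
Proof.
move=> f g h; apply: fpsP => n /=.
by rewrite -big_split; apply: eq_bigr => i _; rewrite mulrDl.
Qed.

Fact fps_one_neq0 : fps_one != 0 :> fps R.
Proof.
apply/eqP => /(congr1 (fun f : fps R => f 0%N)) /= /eqP.
by rewrite oner_eq0.
Qed.

HB.instance Definition _ := GRing.Zmodule_isComNzRing.Build (fps R)
  fps_mulA fps_mulC fps_mul1 fps_mulDl fps_one_neq0.

(* The list of the n first coefficients of the inverse of f. *)
Fixpoint fps_inv_seq f n : seq R :=
  if n is m.+1 then
    let s := fps_inv_seq f m in
    rcons s ((f 0%N)^-1 *
             ((m == 0%N)%:R - \sum_(i < m) f i.+1 * s`_(m - i.+1)))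
  else [::].

Definition fps_unit : pred (fps R) := fun f => f 0%N \is a GRing.unit.

Definition fps_inv f : fps R :=
  if fps_unit f then Fps (fun n => (fps_inv_seq f n.+1)`_n) else f.

Let size_fps_inv_seq f n : size (fps_inv_seq f n) = n.
Proof. by elim: n => //= n IHn; rewrite size_rcons IHn. Qed.

Let nth_fps_inv_seq f n m : (m < n)%N ->
  (fps_inv_seq f n)`_m = (fps_inv_seq f m.+1)`_m.
Proof.
elim: n => // n IHn; rewrite ltnS leq_eqVlt => /predU1P[->//|mn].
by rewrite -IHn//= nth_rcons size_fps_inv_seq mn.
Qed.

Fact fps_mulVf : {in fps_unit, left_inverse 1 fps_inv *%R}.
Proof.
move=> f uf; rewrite mulrC; apply: fpsP => n.
rewrite /fps_inv (_ : fps_unit f = true)//.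
rewrite /GRing.mul/= big_ord_recl /= subn0 nth_rcons size_fps_inv_seq.
rewrite ltnn eqxx mulrA divrr// mul1r.
rewrite -[RHS](subrK (\sum_(i < n) f i.+1 * (fps_inv_seq f n)`_(n - i.+1))).
congr (_ + _); apply: eq_bigr => i _.
rewrite /bump add1n [in RHS]nth_fps_inv_seq//.
by rewrite ltn_subrL/= (leq_ltn_trans _ (ltn_ord i)).
Qed.

Fact fps_unitPl f g : g * f = 1 -> fps_unit f.
Proof.
move=> /(congr1 (fun f : fps R => f 0%N)) /=.
rewrite /GRing.mul/= big_ord1 /= => gf; apply/unitrPr.
by exists (g 0%N); rewrite mulrC; exact: gf.
Qed.

Fact fps_inv_out : {in [predC fps_unit], fps_inv =1 id}.
Proof. by move=> f /negbTE uf; rewrite /fps_inv [fps_unit f]uf. Qed.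

HB.instance Definition _ := GRing.ComNzRing_hasMulInverse.Build (fps R)
  fps_mulVf fps_unitPl fps_inv_out.

Lemma fps_unitP f : (f \is a GRing.unit) = (f 0%N \is a GRing.unit).
Proof. by []. Qed.

Definition fpsX : fps R := Fps (fun n => (n == 1%N)%:R).

Definition fps_bigO (n : nat) : set (fps R) :=
  [set f : fps R | forall i, (i < n)%N -> f i = 0].

End FpsRing.

Arguments fpsX {R}.
Arguments fps_bigO {R} n.

(* [fset_set] sends an infinite set to the empty one, so this is the      *)
(* generating function of A only if A has finitely many elements of each  *)
(* size; for sets of paths this is [finite_dcpath].                       *)
Definition ogf (T : choiceType) (len : T -> nat) (A : set T) : fps int :=
  Fps (fun n => (#|` fset_set (A `&` [set P | len P = n])|)%:Z).

(* [C k] is the step (1,-k). *)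
Inductive step := U | D | C of nat.

Definition step_code (s : step) : option (option nat) :=
  match s with U => None | D => Some None | C k => Some (Some k) end.
Definition step_decode (o : option (option nat)) : step :=
  match o with None => U | Some None => D | Some (Some k) => C k end.
Fact step_codeK : cancel step_code step_decode. Proof. by case. Qed.
HB.instance Definition _ := Countable.copy step (can_type step_codeK).

(* From height h the word w stays in y >= 0, ends on the x-axis, and uses *)
(* each C k only with 2 <= k and from height k.                           *)
Fixpoint dyck_cat (h : nat) (w : seq step) : bool :=
  match w with
  | [::] => h == 0%N
  | U :: w' => dyck_cat h.+1 w'
  | D :: w' => (0 < h)%N && dyck_cat h.-1 w'
  | C k :: w' => [&& (2 <= k)%N, h == k & dyck_cat 0 w']
  end.

Notation dcpath := {w : seq step | dyck_cat 0 w}.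

Definition dclen (P : dcpath) : nat := size (val P).

Lemma finite_dcpath (n : nat) : finite_set [set P : dcpath | dclen P = n].
Proof.
have fin_words m h : finite_set [set w | dyck_cat h w /\ size w = m].
  elim: m h => [|m IHm] h.
    apply: (@sub_finite_set _ _ [set [::]]); last exact: finite_set1.
    by move=> w /= [_ /size0nil ->].
  have fin_cons s k := finite_image (cons s) (IHm k).
  have finU : finite_set
      ((cons U @` [set w | dyck_cat h.+1 w /\ size w = m]) `|`
       (cons D @` [set w | dyck_cat h.-1 w /\ size w = m]) `|`
       (cons (C h) @` [set w | dyck_cat 0 w /\ size w = m])).
    by rewrite !finite_setU.
  apply: sub_finite_set finU => -[|[||k] w] //= [].
  - by [].
  - by move=> Hw [sw]; left; left; exists w.
  - by move=> /andP[_ Hw] [sw]; left; right; exists w.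
  - by move=> /and3P[_ /eqP <- Hw] [sw]; right; exists w.
have := @finite_preimage _ _ _ (val : dcpath -> seq step) _ (fin_words n 0%N).
move=> /(_ (in2W val_inj)); apply: sub_finite_set => P /= <-.
by split => //; exact: valP.
Qed.

Definition UDs (m : nat) : seq step := flatten (nseq m [:: U; D]).

Definition J1_word (n : nat) : seq step :=
  if odd n then UDs ((n - 3) %/ 2) ++ [:: U; U; C 2] else UDs (n %/ 2).

Definition J1 : set dcpath :=
  [set P | exists2 n, n <> 1%N & val P = J1_word n].

(* The indices of alpha and k are shifted down by one. *)
Definition J : set dcpath :=
  J1 `|`
  [set P | exists (r : nat) (alpha : nat -> dcpath) (k : nat -> nat),
    [/\ (1 <= r)%N,
        forall i, (i < r)%N -> (2 <= k i)%N,
        forall i, (i <= r)%N -> J1 (alpha i) &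
        val P = (\big[cat/[::]]_(i < r)
                   (val (alpha i) ++ nseq (k i).+1 U ++ [:: D; C (k i)]))
                ++ val (alpha r)]].

(* Main.v *)
Require Import Defs.
From mathcomp Require Import all_boot all_order all_algebra.
From mathcomp Require Import classical_sets.
From mathcomp Require Import boolp cardinality finmap ring.

(** Reading a path of J from the left, the first block [U^(k+1) D C_k], if any,
    is determined by the path: the prefix [(UD)^m] stops at the first [UU], which
    opens either [UUC_2] or a block, since [k >= 2]. Hence J is the disjoint union
    of J_1 and the unambiguous concatenation J_1 B J, where B is the set of
    blocks, so J(x) = a + a b J(x) with a = 1/(1-x) - x and b = x^5/(1-x). *)

Set Implicit Arguments.
Unset Strict Implicit.
Unset Printing Implicit Defensive.
Import GRing.Theory.
Local Open Scope classical_set_scope.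
Local Open Scope ring_scope.

(** * Formal power series: shifts and the geometric series *)

Section PowerSeries.
Variable R : comUnitRingType.
Implicit Types f g : fps R.

Lemma coef_fpsM f g n : (f * g) n = \sum_(i < n.+1) f i * g (n - i)%N.
Proof. by []. Qed.

Lemma coef_fpsB f g n : (f - g) n = f n - g n.
Proof. by []. Qed.

Lemma coef_fpsXM f n : (fpsX * f) n = if n is m.+1 then f m else 0.
Proof.
rewrite coef_fpsM big_ord_recl /= mul0r add0r.
case: n => [|n]; first by rewrite big_ord0.
rewrite big_ord_recl /= mul1r subSS subn0 big1 ?addr0// => i _.
by rewrite mul0r.
Qed.

Lemma coef_fpsXnM f m n :
  (fpsX ^+ m * f) n = if (n < m)%N then 0 else f (n - m)%N.
Proof.
elim: m n => [|m IHm] n; first by rewrite mul1r subn0.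
by rewrite exprS -mulrA coef_fpsXM; case: n => // n; rewrite IHm subSS.
Qed.

Lemma fps_bigO_XnM n f : fps_bigO n (fpsX ^+ n * f).
Proof. by move=> i lt_in; rewrite coef_fpsXnM lt_in. Qed.

Lemma fps_geometric : (1 - fpsX) * Fps (fun=> 1) = 1 :> fps R.
Proof.
rewrite mulrBl mul1r; apply: fpsP => n.
rewrite coef_fpsB coef_fpsXM.
by case: n => [|n]; rewrite /= ?subr0 ?subrr.
Qed.

End PowerSeries.

(** * Sum and product rules for generating functions *)

Section CombinatorialClasses.
Context {T1 T2 T : choiceType}.
Variables (len1 : T1 -> nat) (len2 : T2 -> nat) (len : T -> nat).

(** Needed because [fset_set] sends infinite sets to the empty one, which would break the
    counting. *)
Definition graded_finite (V : Type) (l : V -> nat) (A : set V) :=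
  forall n, finite_set (A `&` [set P | l P = n]).

Lemma ogf_uniq_seq (A : set T) n (s : seq T) : uniq s ->
  (forall P, P \in s <-> A P /\ len P = n) -> ogf len A n = (size s)%:Z.
Proof.
move=> us sA; congr Posz; apply/perm_size/uniq_perm => //.
have As : A `&` [set P | len P = n] = [set` s].
  by apply/seteqP; split=> P /=; rewrite sA.
by move=> P; rewrite As in_fset_set ?mem_setE//; exact: finite_seq.
Qed.

Lemma ogfU (A B : set T) : graded_finite len A -> graded_finite len B ->
  A `&` B = set0 -> ogf len (A `|` B) = ogf len A + ogf len B.
Proof.
move=> finA finB AB0; apply: fpsP => n.
rewrite [RHS]/(ogf len A n + ogf len B n) /= setIUl fset_setU//.
rewrite cardfsU -fset_setI// setIACA AB0 set0I fset_set0 cardfs0 subn0.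
exact: PoszD.
Qed.

(** Injectivity of [op] on [A] and [B] is unambiguity of the factorization: each product then comes
    from one pair, and pairs are counted by a Cauchy product. *)
Lemma ogf_prod (op : T1 -> T2 -> T) (A : set T1) (B : set T2) :
  graded_finite len1 A -> graded_finite len2 B ->
  (forall u v, len (op u v) = (len1 u + len2 v)%N) ->
  (forall u v u' v', A u -> B v -> A u' -> B v' ->
     op u v = op u' v' -> u = u' /\ v = v') ->
  ogf len [set op p.1 p.2 | p in A `*` B] = ogf len1 A * ogf len2 B.
Proof.
move=> finA finB lenM inj; apply: fpsP => n; rewrite coef_fpsM.
pose SA i := enum_fset (fset_set (A `&` [set P | len1 P = i])).
pose SB i := enum_fset (fset_set (B `&` [set P | len2 P = i])).
have memA i u : u \in SA i <-> A u /\ len1 u = i.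
  by rewrite /SA in_fset_set// in_setE.
have memB i v : v \in SB i <-> B v /\ len2 v = i.
  by rewrite /SB in_fset_set// in_setE.
pose pairs i := [seq (u, v) | u <- SA i, v <- SB (n - i)%N].
(* Grouping by the length [i] of the left factor makes the size of [s] the convolution sum. *)
pose s := [seq op p.1 p.2 | i <- iota 0 n.+1, p <- pairs i].
have memp i p : p \in pairs i ->
    [/\ A p.1, B p.2, len1 p.1 = i & len2 p.2 = (n - i)%N].
  by case/allpairsP => -[u v] /= [/memA[? ?] /memB[? ?] ->].
rewrite (@ogf_uniq_seq _ n s).
- rewrite size_allpairs_dep sumnE big_map -[iota 0 _]/(index_iota 0 n.+1).
  rewrite big_mkord; rewrite (big_morph Posz PoszD (erefl _)).
  by apply: eq_bigr => i _; rewrite size_allpairs.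
- apply: allpairs_uniq_dep; first exact: iota_uniq.
    by move=> i _; apply: allpairs_uniq; rewrite ?fset_uniq// => -[? ?] [? ?].
  move=> _ _ /allpairsPdep[i [p [_ ip ->]]] /allpairsPdep[j [q [_ jq ->]]] /=.
  case: p q ip jq => [u v] [u' v'] /memp[/= Au Bv lu _] /memp[/= Au' Bv' lu' _].
  (* The index is recovered as the length of the left factor. *)
  by case/inj => // eu ev; rewrite -lu -lu' eu ev.
- move=> P; split=> [/allpairsPdep[i [p [+ + ->]]]|[[[u v] [/= Au Bv] <-]]].
    rewrite mem_iota add0n ltnS => /andP[_ le_in] /memp[Ap Bp lA lB].
    by rewrite lenM lA lB subnKC//; split=> //; exists p.
  rewrite lenM => en; apply/allpairsPdep; exists (len1 u), (u, v); split=> //.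
    by rewrite mem_iota add0n ltnS -en leq_addr.
  apply/allpairsP; exists (u, v).
  by split=> //; [apply/memA|apply/memB; rewrite -en addKn].
Qed.

End CombinatorialClasses.

(** * Concatenation of paths, and the words of J_1 *)

(** An accepted word ends on the axis, so [v] is read from height 0. As an equality, this also shows
    that removing a path from the front of a path leaves a path. *)
Lemma dyck_cat_cat h u v : dyck_cat h u -> dyck_cat h (u ++ v) = dyck_cat 0 v.
Proof.
elim: u h => [|[||k] u IHu] h /=.
- by move/eqP->.
- exact: IHu.
- by case/andP=> -> /IHu.
- by case/and3P=> -> -> /IHu.
Qed.

Lemma dyck_cat_catP (P Q : dcpath) : dyck_cat 0 (val P ++ val Q).
Proof. by rewrite dyck_cat_cat; exact: valP. Qed.

Definition dccat (P Q : dcpath) : dcpath := Sub _ (dyck_cat_catP P Q).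

Lemma dclen_cat P Q : dclen (dccat P Q) = (dclen P + dclen Q)%N.
Proof. exact: size_cat. Qed.

Lemma graded_finite_dcpath (A : set dcpath) : graded_finite dclen A.
Proof. by move=> n; apply: sub_finite_set (finite_dcpath n) => P []. Qed.

Lemma dyck_cat_UDs m : dyck_cat 0 (UDs m).
Proof. by elim: m. Qed.

Lemma size_UDs m : size (UDs m) = m.*2.
Proof. by elim: m => //= m ->. Qed.

Lemma dyck_cat_J1_word n : dyck_cat 0 (J1_word n).
Proof. by rewrite /J1_word; case: ifP; rewrite ?dyck_cat_cat ?dyck_cat_UDs. Qed.

(** The exclusion matters: by truncated subtraction [J1_word 1] is UUC_2, of length 3. *)
Lemma size_J1_word n : n <> 1%N -> size (J1_word n) = n.
Proof.
move=> n1; rewrite /J1_word !divn2; case: ifP => [on|en].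
  case: n on n1 => [|[|[|n]]] //= + _; rewrite negbK => /negbTE on.
  by rewrite size_cat size_UDs !subSS subn0 addn3 -[in RHS](odd_double_half n) on.
by rewrite size_UDs -[RHS]odd_double_half en.
Qed.

(** * Blocks and the recursive description of J *)

Definition block_word (k : nat) : seq step := nseq k.+1 U ++ [:: D; C k].

Lemma dyck_cat_block_word k : (2 <= k)%N -> dyck_cat 0 (block_word k).
Proof.
move=> k2; rewrite /block_word.
suff climb h m : dyck_cat h (nseq m U ++ [:: D; C k]) = dyck_cat (h + m)%N [:: D; C k].
  by rewrite climb /= k2 eqxx.
by elim: m h => [|m IHm] h; rewrite ?addn0//= IHm addSnnS.
Qed.

Definition blocks : set dcpath :=
  [set P | exists2 k, (2 <= k)%N & val P = block_word k].

(** Allowing [r = 0] absorbs J_1, so that removing a block never leaves the family. *)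
Lemma J_seqP (P : dcpath) : J P <->
  exists r (alpha : nat -> dcpath) (k : nat -> nat),
    [/\ forall i, (i < r)%N -> (2 <= k i)%N,
        forall i, (i <= r)%N -> J1 (alpha i) &
        val P = (\big[cat/[::]]_(i < r) (val (alpha i) ++ block_word (k i)))
                ++ val (alpha r)].
Proof.
split=> [[PJ1|[r [al [k [_ k2 J1al eP]]]]]|[[|r] [al [k [k2 J1al eP]]]]].
- by exists 0%N, (fun=> P), (fun=> 0%N); split; rewrite ?big_ord0.
- by exists r, al, k.
- by left; move: eP; rewrite big_ord0 => /val_inj->; apply: J1al.
- by right; exists r.+1, al, k.
Qed.

Lemma J_decomposition :
  J = J1 `|` [set dccat p.1 p.2 | p in J1 `*`
        [set dccat q.1 q.2 | q in blocks `*` J]].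
Proof.
apply/seteqP; split=> P.
  case/J_seqP => -[|r] [al [k [k2 J1al eP]]].
    by left; move: eP; rewrite big_ord0 => /val_inj->; apply: J1al.
  right; pose B : dcpath := Sub _ (dyck_cat_block_word (k2 0%N isT)).
  pose w := (\big[cat/[::]]_(i < r) (val (al i.+1) ++ block_word (k i.+1)))
            ++ val (al r.+1).
  have {}eP : val P = val (al 0%N) ++ val B ++ w by rewrite eP big_ord_recl -!catA.
  (* [w] is what remains of [P] after two prefixes that return to the axis. *)
  have dw : dyck_cat 0 w.
    have := valP P; rewrite /= eP (dyck_cat_cat _ (valP (al 0%N))).
    by rewrite (dyck_cat_cat _ (valP B)).
  exists (al 0%N, dccat B (Sub w dw)); last exact/val_inj.
  split; first exact: J1al.
  exists (B, Sub w dw) => //; split; first by exists (k 0%N); rewrite ?k2.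
  apply/J_seqP; exists r, (fun i => al i.+1), (fun i => k i.+1).
  by split=> // i; [exact: (k2 i.+1)|exact: (J1al i.+1)].
case=> [|[[A BQ] [/= J1A [[B Q] [/= [k k2 eB] JQ] <-]] <-]]; first by left.
case/J_seqP: JQ => r [al [ks [ks2 J1al eQ]]]; apply/J_seqP.
exists r.+1, (fun i => if i is j.+1 then al j else A),
  (fun i => if i is j.+1 then ks j else k).
split=> [[|i]//|[|i]//|]; first exact: ks2; first exact: J1al.
by rewrite big_ord_recl /= eB eQ -!catA.
Qed.

(** * Uniqueness of the factorization *)

Lemma UDs_UU_inj m m' r r' :
  UDs m ++ [:: U, U & r] = UDs m' ++ [:: U, U & r'] -> m = m' /\ r = r'.
Proof.
elim: m m' => [|m IHm] [|m'] //=; first by case.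
by case=> /IHm[-> ->].
Qed.

Lemma UDs_neq_UU m m' r : UDs m <> UDs m' ++ [:: U, U & r].
Proof. by elim: m m' => [|m IHm] [|m'] //= [] /IHm. Qed.

Lemma nseq_U_inj k k' r r' :
  nseq k U ++ D :: r = nseq k' U ++ D :: r' -> k = k' /\ r = r'.
Proof.
elim: k k' => [|k IHk] [|k'] //=; first by case.
by case=> /IHk[-> ->].
Qed.

Lemma block_word_inj k k' r r' :
  block_word k ++ r = block_word k' ++ r' -> k = k' /\ r = r'.
Proof.
by rewrite -!catA => /nseq_U_inj[[->] [->]].
Qed.

Lemma J1_block_inj n n' k k' r r' : (2 <= k)%N -> (2 <= k')%N ->
  J1_word n ++ block_word k ++ r = J1_word n' ++ block_word k' ++ r' ->
  J1_word n = J1_word n' /\ block_word k ++ r = block_word k' ++ r'.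
Proof.
(* With [k] at least 2 a block starts with UUU, so both sides have the form (UD)^m UU followed by
   C_2 or U according to the parity; this letter rules out the mixed cases. *)
case: k k' => [|[|k]] [|[|k']] // _ _.
rewrite /J1_word; case: ifP; case: ifP => _ _; rewrite -?catA /=.
all: by case/UDs_UU_inj => -> // [->].
Qed.

(** For even [n] the left side has no UU. For odd [n] it ends with its UUC_2, whereas on the right
    the first UU is followed by U, or by C_2 and then a whole block. *)
Lemma J1_word_neq_block n n' k r : (2 <= k)%N ->
  J1_word n <> J1_word n' ++ block_word k ++ r.
Proof.
case: k => [|[|k]] // _.
rewrite /J1_word; case: ifP; case: ifP => _ _; rewrite -?catA /=.
all: by [case/UDs_UU_inj | move/UDs_neq_UU].
Qed.

(** * The functional equation and its solution *)

Lemma ogf_J_rec : let j := ogf dclen J in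
  j = ogf dclen J1 + ogf dclen J1 * (ogf dclen blocks * j).
Proof.
rewrite /= {1}J_decomposition ogfU; try exact: graded_finite_dcpath; last first.
  rewrite -classical_sets.subset0 => P [[n _ en]] [[A BQ] [/= [n' _ eA]]].
  move=> [[B Q] [/= [k k2 eB] _] <-] eP; move: en.
  by rewrite -eP /= eA eB => /esym/J1_word_neq_block; apply.
congr (_ + _); rewrite (@ogf_prod _ _ _ dclen dclen);
  rewrite ?(@ogf_prod _ _ _ dclen dclen)//;
  try exact: graded_finite_dcpath; try exact: dclen_cat.
- move=> B Q B' Q' [k _ eB] _ [k' _ eB'] _ /(congr1 val) /=.
  rewrite eB eB' => /block_word_inj[kk /val_inj->].
  by split=> //; apply: val_inj; rewrite eB eB' kk.
- move=> A BQ A' BQ' [n _ eA] [[B Q] [[k k2 eB] _] <-].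
  move=> [n' _ eA'] [[B' Q'] [[k' k2' eB'] _] <-] /(congr1 val) /=.
  rewrite /= in eB eB'; rewrite eA eA' eB eB' => /J1_block_inj[]// en er.
  split; apply: val_inj; first by rewrite eA eA' en.
  by rewrite /= eB eB' er.
Qed.

Lemma ogf_J1 : ogf dclen J1 = Fps (fun=> 1) - fpsX.
Proof.
apply: fpsP => n; rewrite coef_fpsB [RHS]/(1 - (n == 1%N)%:R).
case: eqP => [->|n1].
  rewrite (@ogf_uniq_seq _ _ _ _ [::]) ?subrr// => P; split=> //.
  by case=> -[m m1 eP]; rewrite /dclen eP size_J1_word.
rewrite (@ogf_uniq_seq _ _ _ _ [:: Sub _ (dyck_cat_J1_word n)]) ?subr0// => P.
rewrite inE; split=> [/eqP->|[[m m1 eP]]].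
  by split; [exists n|rewrite /dclen /= size_J1_word].
by rewrite /dclen eP size_J1_word// => mn; apply/eqP/val_inj; rewrite eP mn.
Qed.

Lemma size_block_word k : size (block_word k) = (k + 3)%N.
Proof. by rewrite size_cat size_nseq addSnnS. Qed.

(** Block [k] has length [k + 3], so there is exactly one block of each length from 5 on. *)
Lemma ogf_blocks : ogf dclen blocks = fpsX ^+ 5 * Fps (fun=> 1).
Proof.
apply: fpsP => n; rewrite coef_fpsXnM; case: ltnP => [n5|n5].
  rewrite (@ogf_uniq_seq _ _ _ _ [::])// => P; split=> // -[[k k2 eP]].
  rewrite /dclen eP size_block_word => nk.
  by have := leq_add k2 (leqnn 3); rewrite nk leqNgt n5.
have n2 : (2 <= n - 3)%N by rewrite leq_subRL ?(leq_trans _ n5).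
rewrite (@ogf_uniq_seq _ _ _ _ [:: Sub _ (dyck_cat_block_word n2)])// => P.
rewrite inE; split=> [/eqP->|[[k k2 eP]]].
  split; first by exists (n - 3)%N.
  by rewrite [LHS]size_block_word subnK// (leq_trans _ n5).
by rewrite /dclen eP size_block_word => kn; apply/eqP/val_inj; rewrite eP SubK -kn addnK.
Qed.

(** Here [g] stands for 1/(1-x). Multiplying the recurrence by (1-x)^2 clears it from both
    coefficients, leaving an equation linear in [j]. *)
Lemma solve_J_rec (A : comNzRingType) (x g j : A) : (1 - x) * g = 1 ->
  j = (g - x) + (g - x) * (x ^+ 5 * g * j) ->
  j * (x ^+ 7 - x ^+ 6 + x ^+ 5 - x ^+ 2 + 2 * x - 1)
    = x ^+ 3 - 2 * x ^+ 2 + 2 * x - 1.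
Proof.
move=> geo rec.
have aE : (1 - x) * (g - x) = 1 - x + x ^+ 2 by rewrite mulrBr geo; ring.
have jE : (1 - x) ^+ 2 * j = (1 - x + x ^+ 2) * ((1 - x) + x ^+ 5 * j).
  (* The fourth 1 is the factor just put before [x ^+ 5 * j]; replacing it by [(1 - x) * g] makes
     both sides equal as polynomials in [x], [g], [j]. *)
  by rewrite {1}rec -aE -[x ^+ 5 * j]mul1r -{4}geo; ring.
transitivity ((1 - x + x ^+ 2) * (x ^+ 5 * j) - (1 - x) ^+ 2 * j); first by ring.
by rewrite jE; ring.
Qed.

Theorem theorem3p8 :
  let x : fps int := fpsX in
  let Jx : fps int := ogf dclen J in
  Jx = (x ^+ 3 - 2 * x ^+ 2 + 2 * x - 1)
       / (x ^+ 7 - x ^+ 6 + x ^+ 5 - x ^+ 2 + 2 * x - 1)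
  /\ fps_bigO 12
       (Jx - (1 + x ^+ 2 + x ^+ 3 + x ^+ 4 + 2 * x ^+ 5 + 2 * x ^+ 6
              + 4 * x ^+ 7 + 6 * x ^+ 8 + 9 * x ^+ 9 + 14 * x ^+ 10
              + 20 * x ^+ 11)).
Proof.
move=> x Jx.
set num := x ^+ 3 - _ + _ - _; set den := x ^+ 7 - _ + _ - _ + _ - _.
set p := 1 + _ + _ + _ + _ + _ + _ + _ + _ + _ + _.
have geo : (1 - x) * Fps (fun=> 1) = 1 := fps_geometric _.
have Jden : Jx * den = num.
  by apply: (solve_J_rec geo); rewrite {1}/Jx ogf_J_rec ogf_J1 ogf_blocks.
have Uden : den \is a GRing.unit.
  (* This isolates the constant term -1, a unit of [int]. *)
  have dE : den = x * (x ^+ 6 - x ^+ 5 + x ^+ 4 - x + 2) - 1 by rewrite /den; ring.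
  by rewrite fps_unitP dE coef_fpsB coef_fpsXM.
have JE : Jx = num / den by rewrite -Jden mulrK.
split=> //.
(* [q] is the quotient of [num - p * den] by [x ^+ 12], so the error of the expansion is
   [x ^+ 12 * (q / den)]. *)
pose q := - 30 + 16 * x - 7 * x ^+ 2 - 11 * x ^+ 3 - 15 * x ^+ 4 + 6 * x ^+ 5
          - 20 * x ^+ 6.
have numE : num = p * den + x ^+ 12 * q by rewrite /num /p /den /q; ring.
rewrite JE numE mulrDl mulrK// addrAC subrr add0r -mulrA.
exact: fps_bigO_XnM.
Qed.
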